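(* Let $r_1,\theta_0$ be constants with $r_1\neq0$, and put $R_3=\sqrt{n^2+\frac{\theta_0^2}{r_1^2}}$. The geodesics for metrics of self-dual Taub-NUT type with constant $\varphi$, $\tau$, with conditions $$\lim_{r\to R_3}t=t_1,\quad \lim_{r\to R_3}\theta=\theta_1,\quad \lim_{r\to R_3}(r^2-n^2)\frac{d\theta}{dt}=\theta_0,\quad \lim_{r\to R_3}\left[\frac{r+n}{r-n}\left(\frac{dr}{dt}\right)^2+\frac{\theta_0^2}{r^2-n^2}\right]=r_1^2,$$ satisfy $$t(r)=t_1+\frac{\epsilon}{r_1}\left[\sqrt{r^2-R_3^2}+n\ln\left(r+\sqrt{r^2-R_3^2}\right)\right],$$ $$\theta(r)=\theta_1+\epsilon\arctan\frac{r_1(rn-R_3^2)}{\theta_0\sqrt{r^2-R_3^2}},$$ where $\epsilon=\pm1$.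
   Context: The metric of self-dual Taub-NUT type with parameter $n$ is $$ds^2=\frac{r-n}{r+n}(d\tau+2n\cos\theta\, d\varphi)^2+(r^2-n^2)(d\theta^2+\sin^2\theta\, d\varphi^2)+\frac{r+n}{r-n}dr^2$$ in coordinates $(\tau,r,\theta,\varphi)$. Geodesics are solutions of the geodesic equations of this metric with parameter $t$; along them $t$ and $\theta$ are expressed as functions of $r$. Here $t_1$ and $\theta_1$ are constants.
   Formalization: The printed additive constants contradict the limit conditions; in the formulas t_1 is replaced by t_1 − (ε/r_1) n ln R_3 and θ_1 by θ_1 + ε sgn(r_1θ_0) π/2, the values the limits force (for θ_0 = 0 the arctan term is read as 0). *)

(* Defs.v *)
From HB Require Import structures.
From mathcomp Require Import all_boot all_order all_algebra.
From mathcomp Require Import all_classical all_reals all_analysis.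
Set Implicit Arguments.
Unset Strict Implicit.
Unset Printing Implicit Defensive.
Import Order.TTheory GRing.Theory Num.Theory.
Import numFieldNormedType.Exports.
Local Open Scope classical_set_scope.
Local Open Scope ring_scope.

Definition i_tau : 'I_4 := @Ordinal 4 0 isT.
Definition i_r : 'I_4 := @Ordinal 4 1 isT.
Definition i_theta : 'I_4 := @Ordinal 4 2 isT.
Definition i_phi : 'I_4 := @Ordinal 4 3 isT.

Section Geometry.
Variable R : realType.
Implicit Types (g : 'rV[R]_4 -> 'M[R]_4) (p : 'rV[R]_4) (x : R -> 'rV[R]_4).

Definition partial (i : 'I_4) (f : 'rV[R]_4 -> R) (p : 'rV[R]_4) : R :=
  'D_(delta_mx 0 i) f p.

(* Gamma^k_{ij} = 1/2 g^{kl} (d_i g_{lj} + d_j g_{li} - d_l g_{ij}) *)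
Definition christoffel g (k i j : 'I_4) p : R :=
  2^-1 * \sum_l invmx (g p) k l *
    (partial i (fun q => g q l j) p + partial j (fun q => g q l i) p
     - partial l (fun q => g q i j) p).

Definition xcoord x (k : 'I_4) : R -> R := fun t => x t 0 k.

Definition geodesic_on g (I : set R) x : Prop :=
  forall t, I t -> forall k : 'I_4,
    [/\ derivable (xcoord x k) t 1,
        derivable ((xcoord x k)^`()%classic) t 1 &
        ((xcoord x k)^`()%classic)^`()%classic t
        + \sum_i \sum_j christoffel g k i j (x t)
            * (xcoord x i)^`()%classic t * (xcoord x j)^`()%classic t = 0].

Definition dx (i : 'I_4) : 'rV[R]_4 := delta_mx 0 i.
Definition form_sq (w : 'rV[R]_4) : 'M[R]_4 := w^T *m w.

Definition taubnut (n : R) (p : 'rV[R]_4) : 'M[R]_4 :=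
  let r := p 0 i_r in let theta := p 0 i_theta in
  ((r - n) / (r + n)) *: form_sq (dx i_tau + (2 * n * cos theta) *: dx i_phi)
  + (r ^+ 2 - n ^+ 2) *:
      (form_sq (dx i_theta) + (sin theta ^+ 2) *: form_sq (dx i_phi))
  + ((r + n) / (r - n)) *: form_sq (dx i_r).

(* Since det (taubnut n p) = (r^2 - n^2)^2 sin^2 theta, this is exactly where
   the coordinate expression is defined and nondegenerate. *)
Definition taubnut_chart (n : R) : set 'rV[R]_4 :=
  [set p | [/\ p 0 i_r != n, p 0 i_r != - n & sin (p 0 i_theta) != 0]].

End Geometry.

(* Main.v *)
Require Import Defs.
From HB Require Import structures.
From mathcomp Require Import all_boot all_order all_algebra.
From mathcomp Require Import all_classical all_reals all_analysis.
From mathcomp Require Import ring.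
Import Order.TTheory GRing.Theory Num.Theory.
Import numFieldNormedType.Exports.
Local Open Scope classical_set_scope.
Local Open Scope ring_scope.

Set Implicit Arguments.
Unset Strict Implicit.
Unset Printing Implicit Defensive.

(** Since tau and phi are constant, the geodesic moves in a plane with
coordinates (r, theta).  The rows of the metric indexed by r and theta are
diagonal, and their entries depend on r only; so the r and theta components of
the geodesic equation involve only
<<
  g_rr = (r + n) / (r - n)    and    g_thth = r^2 - n^2,
>>
and they are the Euler-Lagrange equations of a central motion.  Two first
integrals follow ([angular_momentum_conserved], [energy_conserved]):
<<
  g_thth theta' = theta0    and    g_rr r'^2 + g_thth theta'^2 = r1^2,
>>
whose values are read off from the limits at the turning radius
rho = sqrt (n^2 + theta0^2 / r1^2).  Eliminating theta' yields
([radial_speed])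
<<
  (r' (r + n))^2 = r1^2 (r^2 - rho^2).
>>
The right-hand side does not vanish along the geodesic.  Indeed r^2 >= rho^2,
and if rho > 0 then r, which accumulates at rho, is positive; an equality
r = rho would be an interior minimum of a function that is continuous and
injective (t is a function of r), which is impossible.  If rho = 0 then
n = theta0 = 0 and the chart excludes r = 0.  So r' (r + n) is a nonvanishing
continuous function on an interval: it has a constant sign, which gives
epsilon ([radial_equation]), and
<<
  dt/dr     = (epsilon / r1) (r + n) / sqrt (r^2 - rho^2),
  dtheta/dr = epsilon theta0 / (r1 (r - n) sqrt (r^2 - rho^2)).
>>
Explicit primitives are [time_primitive] and [angle_primitive]
([planar_motion_solution]).  The constants of integration come from the limits
of the primitives at rho: n ln rho for the first, and, for the second,
-sg (r1 theta0) pi / 2, because the argument of the arctangent is unbounded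
there ([angle_primitive_cvg]).  When theta0 = 0, theta is constant, and the
arctangent is atan 0 by the convention x / 0 = 0. *)

(** * The Taub-NUT metric in the (r, theta) plane *)

Lemma sum_coords (R : realType) (F : 'I_4 -> R) :
  \sum_i F i = F i_tau + F i_r + F i_theta + F i_phi.
Proof.
rewrite !big_ord_recl big_ord0 addr0 -!addrA.
by congr (F _ + (F _ + (F _ + F _))); exact: ord_inj.
Qed.

Lemma coords_cases (i : 'I_4) : [\/ i = i_tau, i = i_r, i = i_theta | i = i_phi].
Proof.
case: i => -[|[|[|[|//]]]] p.
- by apply: Or41; apply/val_inj.
- by apply: Or42; apply/val_inj.
- by apply: Or43; apply/val_inj.
- by apply: Or44; apply/val_inj.
Qed.

(** The difference quotient along a coordinate direction is the one-variable
difference quotient, so no differentiability of [F] has to be assumed. *)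
Lemma partial_coord (R : realType) (F : R -> R) (i : 'I_4) (p : 'rV[R]_4) :
  partial i (fun q => F (q 0 i)) p = F^`()%classic (p 0 i).
Proof.
rewrite /partial derive1E /derive.
set d := (fun _ : R => _); set d' := (fun _ : R => _).
suff -> : d = d' by [].
by apply/funext => h; rewrite /d /d' /= !mxE !eqxx mulr1 [h *: 1]mulr1.
Qed.

Lemma partial_other_coord (R : realType) (F : R -> R) (i j : 'I_4)
    (p : 'rV[R]_4) :
  i != j -> partial i (fun q => F (q 0 j)) p = 0.
Proof.
move=> ij; rewrite /partial /derive.
under eq_fun do rewrite /= !mxE eq_sym (negbTE ij) andbF mulr0 add0r subrr scaler0.
exact: lim_cst.
Qed.

(** The Christoffel symbols contain the inverse of the whole metric, of which
only two rows matter here.  A row of [A] that is diagonal stays so in the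
inverse: [a *: 'e_k = 'e_k *m A] gives ['e_k *m invmx A = a^-1 *: 'e_k]. *)
Lemma invmx_diag_row (R : realType) (k : 'I_4) (A : 'M[R]_4) (a : R) :
  A \in unitmx -> a != 0 -> row k A = a *: delta_mx 0 k ->
  forall l, invmx A k l = (k == l)%:R / a.
Proof.
move=> uA a0 Ak l.
have : row k 1%:M *m (A *m invmx A) = row k 1%:M by rewrite mulmxV // mulmx1.
rewrite mulmxA -row_mul mul1mx Ak -scalemxAl -rowE => /rowP/(_ l).
rewrite !mxE => e; rewrite -e; field.
by [].
Qed.

Section Metric.
Variable R : realType.
Implicit Types (n : R) (p : 'rV[R]_4).

Definition metric_rr n (r : R) : R := (r + n) / (r - n).
Definition metric_thth n (r : R) : R := r ^+ 2 - n ^+ 2.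

Lemma row_r_taubnut n p :
  row i_r (taubnut n p) = metric_rr n (p 0 i_r) *: delta_mx 0 i_r.
Proof.
apply/rowP => j; rewrite !mxE !big_ord_recl !big_ord0 !mxE /=.
by case: (coords_cases j) => -> /=; rewrite /metric_rr; ring.
Qed.

Lemma row_theta_taubnut n p :
  row i_theta (taubnut n p) = metric_thth n (p 0 i_r) *: delta_mx 0 i_theta.
Proof.
apply/rowP => j; rewrite !mxE !big_ord_recl !big_ord0 !mxE /=.
by case: (coords_cases j) => -> /=; rewrite /metric_thth; ring.
Qed.

(** A row vector in the kernel vanishes: the r and theta columns kill its r and
theta entries, and subtracting [2 n cos theta] times the tau column from the phi
column isolates its phi entry. *)
Lemma taubnut_unit n p : taubnut_chart n p -> taubnut n p \in unitmx.
Proof.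
case=> rn rNn sth.
have gr0 : p 0 i_r - n != 0 by rewrite subr_eq0.
have gr0' : p 0 i_r + n != 0 by rewrite addr_eq0.
have rr0 : p 0 i_r ^+ 2 - n ^+ 2 != 0 by rewrite subr_sqr mulf_neq0.
rewrite -row_free_unit; apply: inj_row_free => v vg.
have e j : \sum_k v 0 k * taubnut n p k j = 0.
  by move/rowP: vg => /(_ j); rewrite !mxE.
have et := e i_tau; have er := e i_r; have eth := e i_theta; have ep := e i_phi.
rewrite !sum_coords !mxE !big_ord_recl !big_ord0 !mxE /= in et er eth ep.
move: et er eth ep; rewrite !(mulr0, mul0r, addr0, add0r, mulr1, mul1r).
set a := (_ - _) / _; set c := 2 * n * _; set b := (_ - _) * _ => et er eth ep.
have a0 : a != 0 by rewrite mulf_neq0 ?invr_eq0.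
have b0 : b != 0 by rewrite mulf_neq0 // sqrf_eq0.
have vr : v 0 i_r = 0.
  by move/eqP: er; rewrite !mulf_eq0 invr_eq0 (negbTE gr0) (negbTE gr0') !orbF => /eqP.
have vth : v 0 i_theta = 0 by move/eqP: eth; rewrite mulf_eq0 (negbTE rr0) orbF => /eqP.
have vp : v 0 i_phi = 0.
  have : v 0 i_phi * b = 0.
    transitivity ((v 0 i_tau * (a * c) + v 0 i_phi * (a * (c * c) + b))
      - c * (v 0 i_tau * a + v 0 i_phi * (a * c))); first by ring.
    by rewrite ep et; ring.
  by move/eqP; rewrite mulf_eq0 (negbTE b0) orbF => /eqP.
have vt : v 0 i_tau = 0.
  by move/eqP: et; rewrite vp mul0r addr0 mulf_eq0 (negbTE a0) orbF => /eqP.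
by apply/rowP => j; rewrite mxE; case: (coords_cases j) => ->.
Qed.

Lemma christoffel_diag_row (g : 'rV[R]_4 -> 'M[R]_4) (k i j : 'I_4) p (a : R) :
  g p \in unitmx -> a != 0 -> row k (g p) = a *: delta_mx 0 k ->
  christoffel g k i j p = (2 * a)^-1 *
    (partial i (fun q => g q k j) p + partial j (fun q => g q k i) p
     - partial k (fun q => g q i j) p).
Proof.
move=> ug a0 gk; rewrite /christoffel (bigD1 k) //= big1 => [|l lk].
  by rewrite (invmx_diag_row ug a0 gk) eqxx addr0 invfM mul1r mulrA.
by rewrite (invmx_diag_row ug a0 gk) eq_sym (negbTE lk) !mul0r.
Qed.

(** The next four lemmas put the entries of the (r, theta) block in the form that
[partial_coord] and [partial_other_coord] differentiate. *)
Lemma taubnut_rr n :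
  (fun q => taubnut n q i_r i_r) = (fun q => metric_rr n (q 0 i_r)).
Proof.
by apply/funext => q; move/rowP: (row_r_taubnut n q) => /(_ i_r); rewrite !mxE mulr1.
Qed.

Lemma taubnut_rtheta n : (fun q => taubnut n q i_r i_theta) = cst (0 : R).
Proof.
apply/funext => q; move/rowP: (row_r_taubnut n q) => /(_ i_theta).
by rewrite !mxE mulr0.
Qed.

Lemma taubnut_thetar n : (fun q => taubnut n q i_theta i_r) = cst (0 : R).
Proof.
apply/funext => q; move/rowP: (row_theta_taubnut n q) => /(_ i_r).
by rewrite !mxE mulr0.
Qed.

Lemma taubnut_thetatheta n :
  (fun q => taubnut n q i_theta i_theta) = (fun q => metric_thth n (q 0 i_r)).
Proof.
apply/funext => q; move/rowP: (row_theta_taubnut n q) => /(_ i_theta).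
by rewrite !mxE mulr1.
Qed.

Lemma is_derive_metric_thth n (r : R) : is_derive r 1 (metric_thth n) (2 * r).
Proof.
have -> : metric_thth n = (id ^+ 2 - cst (n ^+ 2)) by apply/funext.
by apply: is_derive_eq; rewrite /GRing.scale /=; ring.
Qed.

Lemma is_derive_metric_rr n (r : R) :
  r != n -> is_derive r 1 (metric_rr n) (- (2 * n) / (r - n) ^+ 2).
Proof.
move=> rn; have rn0 : r - n != 0 by rewrite subr_eq0.
have -> : metric_rr n = (id + cst n) * (fun s => ((id - cst n) s)^-1) by apply/funext.
have dV := @is_deriveV _ (id - cst n) r _ _ rn0
  (is_deriveB (is_derive_id r 1) (is_derive_cst n r 1)).
apply: is_derive_eq; rewrite /GRing.scale /= !fctE.
by field.
Qed.

Lemma derive1_metric_thth n (r : R) : (metric_thth n)^`()%classic r = 2 * r.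
Proof. by rewrite derive1E; have [] := is_derive_metric_thth n r. Qed.

Lemma derive1_metric_rr n (r : R) :
  r != n -> (metric_rr n)^`()%classic r = - (2 * n) / (r - n) ^+ 2.
Proof. by move=> rn; rewrite derive1E; have [] := is_derive_metric_rr rn. Qed.

Lemma sum_two_velocities (G : 'I_4 -> 'I_4 -> R) (v : 'I_4 -> R) :
  v i_tau = 0 -> v i_phi = 0 ->
  \sum_i \sum_j G i j * v i * v j =
  G i_r i_r * v i_r ^+ 2 + (G i_r i_theta + G i_theta i_r) * (v i_r * v i_theta)
  + G i_theta i_theta * v i_theta ^+ 2.
Proof. by move=> vt vp; rewrite !sum_coords vt vp; ring. Qed.

Section GeodesicEquations.
Variables (n : R) (I : set R) (x : R -> 'rV[R]_4) (t : R).
Hypotheses (It : I t) (geo : geodesic_on (taubnut n) I x).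
Hypothesis chart : taubnut_chart n (x t).
Hypotheses (dtau : (xcoord x i_tau)^`()%classic t = 0)
           (dphi : (xcoord x i_phi)^`()%classic t = 0).
Let r := xcoord x i_r.
Let th := xcoord x i_theta.

(** This is [(g_thth theta')' = 0] in expanded form. *)
Lemma geodesic_theta_equation :
  metric_thth n (r t) * th^`()%classic^`()%classic t
    + 2 * r t * r^`()%classic t * th^`()%classic t = 0.
Proof.
have [rn rNn _] := chart; have u := taubnut_unit chart.
have g0 : metric_thth n (r t) != 0.
  by rewrite /metric_thth subr_sqr mulf_neq0 // ?subr_eq0 // addr_eq0.
have [_ _] := geo It i_theta.
rewrite (@sum_two_velocities
  (fun i j => christoffel (taubnut n) i_theta i j (x t)) _ dtau dphi).
have rowth := row_theta_taubnut n (x t).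
rewrite !(christoffel_diag_row _ _ u g0 rowth).
rewrite taubnut_rr taubnut_rtheta taubnut_thetar taubnut_thetatheta.
rewrite !partial_coord !partial_other_coord // /partial !derive_cst.
rewrite derive1_metric_thth.
rewrite -/r -/th => e.
rewrite -[RHS](mulr0 (metric_thth n (r t))) -e.
rewrite /r /xcoord in g0 *.
by field.
Qed.

(** The Euler-Lagrange equation
[(2 g_rr r')' = (dg_rr/dr) r'^2 + (dg_thth/dr) theta'^2] in expanded form. *)
Lemma geodesic_r_equation :
  2 * metric_rr n (r t) * r^`()%classic^`()%classic t
    - 2 * n / (r t - n) ^+ 2 * r^`()%classic t ^+ 2
    - 2 * r t * th^`()%classic t ^+ 2 = 0.
Proof.
have [rn rNn _] := chart; have u := taubnut_unit chart.
have g0 : metric_rr n (r t) != 0.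
  by rewrite /metric_rr mulf_neq0 // ?invr_eq0 ?subr_eq0 // addr_eq0.
have [_ _] := geo It i_r.
rewrite (@sum_two_velocities
  (fun i j => christoffel (taubnut n) i_r i j (x t)) _ dtau dphi).
have rowr := row_r_taubnut n (x t).
rewrite !(christoffel_diag_row _ _ u g0 rowr).
rewrite taubnut_rr taubnut_rtheta taubnut_thetar taubnut_thetatheta.
rewrite !partial_coord !partial_other_coord // /partial !derive_cst.
rewrite derive1_metric_thth derive1_metric_rr //.
rewrite -/r -/th => e.
rewrite -[RHS](mulr0 (2 * metric_rr n (r t))) -e.
rewrite /r /xcoord in g0 *.
have rn0 : x t 0 i_r - n != 0 by rewrite subr_eq0.
field.
by rewrite g0 rn0.
Qed.

End GeodesicEquations.
End Metric.

(** * Functions on an interval and limits at a limit point *)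

Section Calculus.
Variable R : realType.
Implicit Types (I J : set R) (f g : R -> R) (a l m t : R).

Lemma is_derive_derive1 f t : derivable f t 1 -> is_derive t 1 f (f^`()%classic t).
Proof. by move=> /derivableP; rewrite derive1E. Qed.

Lemma is_derive_continuous f t l : is_derive t 1 f l -> {for t, continuous f}.
Proof. by move=> ?; apply/differentiable_continuous/derivable1_diffP. Qed.

Lemma derive1_locally_cst I f t l :
  open I -> (forall s, I s -> f s = l) -> I t -> f^`()%classic t = 0.
Proof.
move=> oI fl It; rewrite derive1E.
rewrite (@near_eq_derive _ _ _ _ (cst l)) ?derive_cst ?oner_eq0 //.
have : nbhs t I by apply: open_nbhs_nbhs.
by apply: filterS => s /fl.
Qed.

Lemma continuous_on_within I f s t :
  is_interval I -> (forall u, I u -> {for u, continuous f}) -> I s -> I t ->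
  {within `[s, t], continuous f}.
Proof.
move=> iI cf Is It; apply: continuous_in_subspaceT => u.
by rewrite inE /= in_itv /= => sut; apply: cf; exact: (iI _ _ Is It).
Qed.

Lemma derive0_interval_cst I f :
  is_interval I -> (forall t, I t -> is_derive t 1 f 0) ->
  forall s t, I s -> I t -> f s = f t.
Proof.
move=> iI df s t; wlog st : s t / s <= t => [H|] Is It.
  by case: (leP s t) => [|/ltW] st; [exact: H|symmetry; exact: H].
have [u|| c _] := @MVT_segment R f (cst 0) s t st.
- by rewrite in_itv /= => /andP[su ut]; apply/df/(iI _ _ Is It); rewrite !ltW.
- apply: (continuous_on_within iI) Is It => u Iu.
  exact: is_derive_continuous (df u Iu).
- by rewrite mul0r => /subr0_eq.
Qed.

Lemma nonvanishing_cst_sign I f :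
  is_interval I -> (forall t, I t -> {for t, continuous f}) ->
  (forall t, I t -> f t != 0) ->
  exists2 eps, eps = 1 \/ eps = - 1 & forall t, I t -> 0 < eps * f t.
Proof.
move=> iI cf f0.
have [[t0 It0]|I0] := pselect (exists t, I t); last first.
  by exists 1; [left|move=> t It; case: I0; exists t].
have same s t : I s -> I t -> f s < 0 -> 0 < f t -> False.
  move=> Is It fs ft.
  have [st|/ltW ts] := leP s t.
    have [|c /=] := IVT st (continuous_on_within iI cf Is It) (v := 0).
      by rewrite ge_min le_max (ltW fs) (ltW ft) orbT.
    rewrite in_itv /= => sct fc.
    by have := f0 _ (iI _ _ Is It _ sct); rewrite fc eqxx.
  have [|c /=] := IVT ts (continuous_on_within iI cf It Is) (v := 0).
    by rewrite ge_min le_max (ltW fs) (ltW ft) !orbT.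
  rewrite in_itv /= => sct fc.
  by have := f0 _ (iI _ _ It Is _ sct); rewrite fc eqxx.
have [ft0|ft0|ft0] := ltgtP (f t0) 0.
- exists (- 1); [by right|move=> t It; rewrite mulN1r oppr_gt0].
  have := f0 _ It; rewrite neq_lt => /orP[//|ft].
  by case: (same _ _ It0 It ft0 ft).
- exists 1; [by left|move=> t It; rewrite mul1r].
  have := f0 _ It; rewrite neq_lt => /orP[ft|//].
  by case: (same _ _ It It0 ft ft0).
- by have := f0 _ It0; rewrite ft0 eqxx.
Qed.

(** A value [m] slightly above the minimum [f t0] would be taken on both sides of
[t0], by the intermediate value theorem. *)
Lemma injective_no_interior_min I f t0 :
  open I -> is_interval I -> (forall t, I t -> {for t, continuous f}) ->
  {in I &, injective f} -> I t0 -> (forall t, I t -> f t0 <= f t) -> False.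
Proof.
move=> oI iI cf fI It0 fmin.
have /nbhs_ballP[e /= e0 eI] : nbhs t0 I by apply: open_nbhs_nbhs.
have d0 : 0 < e / 2 by rewrite divr_gt0.
have de : e / 2 < e by rewrite ltr_pdivrMr // mulr2n mulrDr mulr1 ltrDl.
pose a := t0 - e / 2; pose b := t0 + e / 2.
have Ia : I a by apply: eI; rewrite /ball /= /a opprB addrC subrK gtr0_norm.
have Ib : I b.
  by apply: eI; rewrite /ball /= /b opprD addrA subrr sub0r normrN gtr0_norm.
have at0 : a < t0 by rewrite /a gtrBl.
have t0b : t0 < b by rewrite /b ltrDl.
pose m := Num.min (f a) (f b).
have fa : f t0 < f a.
  rewrite lt_neqAle fmin // andbT; apply/eqP => e1.
  by move: at0; rewrite (fI _ _ _ _ e1) ?inE // ltxx.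
have fb : f t0 < f b.
  rewrite lt_neqAle fmin // andbT; apply/eqP => e1.
  by move: t0b; rewrite (fI _ _ _ _ e1) ?inE // ltxx.
have t0m : f t0 < m by rewrite lt_min fa fb.
have [|c cat fc] := IVT (ltW at0) (continuous_on_within iI cf Ia It0) (v := m).
  by rewrite ge_min (ltW t0m) orbT le_max ge_min lexx.
have [|d dtb fd] := IVT (ltW t0b) (continuous_on_within iI cf It0 Ib) (v := m).
  by rewrite ge_min (ltW t0m) le_max !ge_min lexx !orbT.
move: cat dtb; rewrite !in_itv /= => /andP[ac ct] /andP[td db].
have cd : c = d.
  apply: fI; rewrite ?inE ?fc ?fd //.
    by apply: (iI _ _ Ia It0); rewrite ac.
  by apply: (iI _ _ It0 Ib); rewrite td.
have ct0 : c = t0 by apply/eqP; rewrite eq_le ct cd td.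
by move: t0m; rewrite -fc ct0 ltxx.
Qed.

Lemma limit_point_within_proper J a :
  limit_point J a -> ProperFilter (within J a^').
Proof.
move=> Ja; apply: Build_ProperFilter_ex => A.
rewrite /within /= => /Ja [y [ya Jy Ay]].
by exists y; apply: Ay.
Qed.

Lemma cvg_within_dnbhs J a f :
  {for a, continuous f} -> f r @[r --> within J a^'] --> f a.
Proof.
move=> cf; apply: cvg_trans cf; apply: cvg_app => A aA.
by apply: filterS aA.
Qed.

(** Every constant of the motion and every constant of integration is identified
by this uniqueness of limits along [J]. *)
Lemma limits_agree J a f g l m :
  limit_point J a -> (forall r, J r -> f r = g r) ->
  f r @[r --> within J a^'] --> l -> g r @[r --> within J a^'] --> m -> l = m.
Proof.
move=> Ja fg fl gm; have pF := limit_point_within_proper Ja.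
apply: (cvg_unique _ fl) => //.
apply: cvg_trans gm; apply: near_eq_cvg.
by rewrite near_withinE; near=> r => Jr; rewrite fg.
Unshelve. all: by end_near. Qed.

End Calculus.

(** * Primitives of the radial and angular equations *)

Section Primitives.
Variable R : realType.
Implicit Types (J : set R) (n k r rho : R).

Definition radial_sqrt rho r : R := Num.sqrt (r ^+ 2 - rho ^+ 2).

Definition time_primitive n rho r : R :=
  radial_sqrt rho r + n * ln (r + radial_sqrt rho r).

Definition angle_primitive n k rho r : R :=
  atan (k * ((r * n - rho ^+ 2) / radial_sqrt rho r)).

Lemma is_derive_radial_sqrt rho r :
  0 < r ^+ 2 - rho ^+ 2 ->
  is_derive r 1 (radial_sqrt rho) (r / radial_sqrt rho r).
Proof.
move=> S0.
have S1 : radial_sqrt rho r != 0 by rewrite gt_eqF // sqrtr_gt0.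
have dq : is_derive r 1 (metric_thth rho) (2 * r) by exact: is_derive_metric_thth.
have ds := @is_derive1_sqrt R (metric_thth rho r) S0.
apply: (is_derive_eq (f := radial_sqrt rho) (is_derive1_comp ds dq)).
rewrite -[Num.sqrt (metric_thth rho r)]/(radial_sqrt rho r).
by field.
Qed.

Lemma radial_sqrt_continuous rho r : {for r, continuous (radial_sqrt rho)}.
Proof.
apply: (@continuous_comp _ _ _ (metric_thth rho) Num.sqrt); last exact: sqrt_continuous.
exact: is_derive_continuous (is_derive_metric_thth rho r).
Qed.

(** The logarithm needs [r > 0], but for [n = 0] it disappears and negative [r]
are allowed; that case occurs, since the flat chart contains [r < 0]. *)
Lemma is_derive_time_primitive n rho r :
  0 < r ^+ 2 - rho ^+ 2 -> n = 0 \/ 0 < r ->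
  is_derive r 1 (time_primitive n rho) ((r + n) / radial_sqrt rho r).
Proof.
move=> S0 nr; have dS := is_derive_radial_sqrt S0.
have Sp : 0 < radial_sqrt rho r by rewrite sqrtr_gt0.
case: nr => [->|r0].
  rewrite (_ : time_primitive 0 rho = radial_sqrt rho) ?addr0 //.
  by apply/funext => s; rewrite /time_primitive mul0r addr0.
have rS : 0 < (id + radial_sqrt rho) r by rewrite addr_gt0.
have dln := is_derive1_ln rS.
have -> : time_primitive n rho =
  radial_sqrt rho + n \*: (@ln R \o (id + radial_sqrt rho)) by apply/funext.
apply: is_derive_eq; rewrite /GRing.scale /=.
rewrite fctE in rS *.
by field; rewrite !gt_eqF.
Qed.

(** With [S = radial_sqrt rho r] and [u] the argument of the arctangent, the
relation between [theta0] and [rho] makes both quantities factor: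
[1 + u^2 = r1^2 rho^2 (r - n)^2 / (theta0 S)^2] and
[du/dr = (r1 / theta0) rho^2 (r - n) / S^3]. *)
Lemma is_derive_angle_primitive n (r1 theta0 : R) rho r :
  r1 != 0 -> theta0 != 0 -> theta0 ^+ 2 = r1 ^+ 2 * (rho ^+ 2 - n ^+ 2) ->
  0 < r ^+ 2 - rho ^+ 2 -> rho != 0 -> r != n ->
  is_derive r 1 (angle_primitive n (r1 / theta0) rho)
    (theta0 / (r1 * radial_sqrt rho r * (r - n))).
Proof.
move=> r10 th0 e S0 rho0 rn.
have rn0 : r - n != 0 by rewrite subr_eq0.
have dS := is_derive_radial_sqrt S0.
have Sp : radial_sqrt rho r != 0 by rewrite gt_eqF // sqrtr_gt0.
have S2 : radial_sqrt rho r ^+ 2 = r ^+ 2 - rho ^+ 2 by rewrite sqr_sqrtr // ltW.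
have dV := is_deriveV Sp dS.
have -> : angle_primitive n (r1 / theta0) rho = @atan R \o
  ((r1 / theta0) \*: ((n \*: id - cst (rho ^+ 2)) * (fun s => (radial_sqrt rho s)^-1))).
  by apply/funext => s; rewrite /angle_primitive /= [s * n]mulrC.
apply: is_derive_eq; rewrite /GRing.scale /= !fctE /= /GRing.scale /=.
set S := radial_sqrt rho r in Sp S2 *.
have u2 : 1 + (r1 / theta0 * ((n * r - rho ^+ 2) / S)) ^+ 2 =
    r1 ^+ 2 * rho ^+ 2 * (r - n) ^+ 2 / (theta0 ^+ 2 * S ^+ 2).
  have -> : r1 ^+ 2 * rho ^+ 2 * (r - n) ^+ 2 =
      theta0 ^+ 2 * S ^+ 2 + r1 ^+ 2 * (n * r - rho ^+ 2) ^+ 2.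
    by rewrite e S2; ring.
  by field; rewrite Sp.
have -> : (n * r - rho ^+ 2) * (- S ^- 2 * (r / S)) + S^-1 * (n * 1 - 0)
    = rho ^+ 2 * (r - n) / S ^+ 3.
  have -> : rho ^+ 2 * (r - n) = n * S ^+ 2 - (n * r - rho ^+ 2) * r.
    by rewrite S2; ring.
  by field.
rewrite u2; field.
by rewrite rn0 Sp r10 th0 rho0.
Qed.

Lemma time_primitive_cvg J n rho :
  0 < rho \/ n = 0 ->
  time_primitive n rho r @[r --> within J rho^'] --> n * ln rho.
Proof.
move=> rn.
have S0 : radial_sqrt rho rho = 0 by rewrite /radial_sqrt subrr sqrtr0.
have -> : n * ln rho = time_primitive n rho rho.
  by rewrite /time_primitive S0 add0r addr0.
apply: cvg_within_dnbhs.
have cS := @radial_sqrt_continuous rho rho.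
case: rn => [rho0|->]; last first.
  rewrite (_ : time_primitive 0 rho = radial_sqrt rho) //.
  by apply/funext => s; rewrite /time_primitive mul0r addr0.
apply: continuousD => //; apply: continuousM; first exact: cst_continuous.
apply: (@continuous_comp _ _ _ (id + radial_sqrt rho) (@ln R)).
  by apply: continuousD.
by apply: continuous_ln; rewrite fctE S0 addr0.
Qed.

(** As [r] decreases to [rho], the numerator [r n - rho^2] tends to
[rho (n - rho) < 0] and the denominator to [0+], so the argument of the arctangent
tends to infinity with the sign of [- k]. *)
Lemma angle_primitive_cvg J n k rho :
  0 < rho -> n < rho -> k != 0 -> (forall r, J r -> rho < r) ->
  limit_point J rho ->
  angle_primitive n k rho r @[r --> within J rho^'] --> - (Num.sg k * (pi / 2)).
Proof.
move=> rho0 nrho k0 Jrho Jlim; have pF := limit_point_within_proper Jlim.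
(* The argument of the arctangent is [- sg k * w r], and [w] is positive near
   [rho]. *)
pose w (r : R) : R := `|k| * ((rho ^+ 2 - r * n) / radial_sqrt rho r).
have cnum : {for rho, continuous (fun r => rho ^+ 2 - r * n)}.
  apply: continuousB; first exact: cst_continuous.
  by apply: continuousM => //; exact: cst_continuous.
have num0 : 0 < rho ^+ 2 - rho * n by rewrite subr_gt0 expr2 ltr_pM2l.
have wp : \forall r \near within J rho^', 0 < w r.
  have np := cvgr_gt _ (@cvg_within_dnbhs _ J _ _ cnum) 0 num0.
  near=> r; rewrite /w mulr_gt0 ?normr_gt0 // divr_gt0 //.
    by near: r; exact: np.
  have Jr : J r by near: r; rewrite near_withinE; near do move=> //.
  have r0 := lt_trans rho0 (Jrho r Jr).
  by rewrite sqrtr_gt0 subr_gt0 ltr_pXn2r ?nnegrE ?Jrho // ltW.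
have wV : (fun r => (w r)^-1) @ within J rho^' --> (0 : R).
  pose v (r : R) := `|k|^-1 * (radial_sqrt rho r / (rho ^+ 2 - r * n)).
  have -> : (fun r => (w r)^-1) = v.
    by apply/funext => r; rewrite /w /v !invfM invrK [X in _ * X]mulrC.
  have <- : v rho = 0 by rewrite /v /radial_sqrt subrr sqrtr0 mul0r mulr0.
  apply: cvg_within_dnbhs.
  apply: continuousM; first exact: cst_continuous.
  apply: continuousM; first exact: radial_sqrt_continuous.
  by apply: continuousV => //; rewrite gt_eqF.
have wy : w r @[r --> within J rho^'] --> +oo by apply/gtr0_cvgV0.
have aw : - (Num.sg k * atan (w r)) @[r --> within J rho^'] --> - (Num.sg k * (pi / 2)).
  apply: cvgN; apply: cvgM; first exact: cvg_cst.
  exact: cvg_comp wy (@cvgy_atan R).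
have -> // : angle_primitive n k rho = fun r => - (Num.sg k * atan (w r)).
apply/funext => r; rewrite /angle_primitive.
have -> : k * ((r * n - rho ^+ 2) / radial_sqrt rho r) = - (Num.sg k * w r).
  by rewrite /w [in RHS]mulrA -numEsg; ring.
rewrite atanN; congr (- _).
by case: (sgrP k) k0 => // _ _; rewrite ?mul1r // !mulN1r atanN.
Unshelve. all: by end_near. Qed.

End Primitives.

(** * First integrals and integration of the planar motion *)

Section PlanarMotion.
Variables (R : realType) (n : R) (I : set R) (r th : R -> R).
Hypothesis iI : is_interval I.
Hypothesis chart : forall t, I t -> r t != n /\ r t != - n.
Hypothesis dr : forall t, I t ->
  derivable r t 1 /\ derivable r^`()%classic t 1.
Hypothesis dth : forall t, I t ->
  derivable th t 1 /\ derivable th^`()%classic t 1.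
Hypothesis theta_equation : forall t, I t ->
  metric_thth n (r t) * th^`()%classic^`()%classic t
    + 2 * r t * r^`()%classic t * th^`()%classic t = 0.
Hypothesis r_equation : forall t, I t ->
  2 * metric_rr n (r t) * r^`()%classic^`()%classic t
    - 2 * n / (r t - n) ^+ 2 * r^`()%classic t ^+ 2
    - 2 * r t * th^`()%classic t ^+ 2 = 0.

Lemma angular_momentum_conserved s t : I s -> I t ->
  metric_thth n (r s) * th^`()%classic s = metric_thth n (r t) * th^`()%classic t.
Proof.
apply: (derive0_interval_cst (f := (metric_thth n \o r) * th^`()%classic) iI) => {}t It.
have [/is_derive_derive1 dr1 _] := dr It.
have [_ /is_derive_derive1 dth2] := dth It.
have dg := is_derive_metric_thth n (r t).
apply: is_derive_eq; rewrite /GRing.scale /= -[RHS](theta_equation It).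
by ring.
Qed.

(** The derivative of the energy is [r'] times the r equation plus [2 theta'] times
the theta equation. *)
Lemma energy_conserved s t : I s -> I t ->
  metric_rr n (r s) * r^`()%classic s ^+ 2 + metric_thth n (r s) * th^`()%classic s ^+ 2 =
  metric_rr n (r t) * r^`()%classic t ^+ 2 + metric_thth n (r t) * th^`()%classic t ^+ 2.
Proof.
pose K := (metric_rr n \o r) * (r^`()%classic * r^`()%classic)
  + (metric_thth n \o r) * (th^`()%classic * th^`()%classic).
suff dK u : I u -> is_derive u 1 K 0.
  by move=> Is It; rewrite !expr2; exact: (derive0_interval_cst iI dK Is It).
move=> Iu.
have [/is_derive_derive1 dr1 /is_derive_derive1 dr2] := dr Iu.
have [/is_derive_derive1 dth1 /is_derive_derive1 dth2] := dth Iu.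
have dg := is_derive1_comp (is_derive_metric_thth n (r u)) dr1.
have dg' := is_derive1_comp (is_derive_metric_rr (chart Iu).1) dr1.
apply: is_derive_eq
  (is_deriveD (is_deriveM dg' (is_deriveM dr2 dr2))
              (is_deriveM dg (is_deriveM dth2 dth2))) _.
have := theta_equation Iu; have := r_equation Iu.
rewrite /GRing.scale /= !fctE.
move: (r^`()%classic u) (r^`()%classic^`()%classic u) (th^`()%classic u)
  (th^`()%classic^`()%classic u) (metric_rr n (r u)) (metric_thth n (r u))
  => r' r'' th' th'' a b er eth.
transitivity (r' * (2 * a * r'' - 2 * n / (r u - n) ^+ 2 * r' ^+ 2
                    - 2 * r u * th' ^+ 2)
    + 2 * th' * (b * th'' + 2 * r u * r' * th')).
  by ring.
by rewrite er eth !mulr0 addr0.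
Qed.

Variables (r1 theta0 rho : R).
Hypothesis r1_neq0 : r1 != 0.
Hypothesis rho_ge0 : 0 <= rho.
Hypothesis rho2 : rho ^+ 2 = n ^+ 2 + theta0 ^+ 2 / r1 ^+ 2.
Hypothesis momentum : forall t, I t -> metric_thth n (r t) * th^`()%classic t = theta0.
Hypothesis energy : forall t, I t ->
  metric_rr n (r t) * r^`()%classic t ^+ 2 + metric_thth n (r t) * th^`()%classic t ^+ 2
  = r1 ^+ 2.

(** The product [r' (r + n)] is used in place of [r'] because its square is a
polynomial in [r]. *)
Let q t := r^`()%classic t * (r t + n).

Lemma turning_radius_gt0_or_flat : 0 < rho \/ rho = 0 /\ n = 0.
Proof.
move: rho_ge0; rewrite le_eqVlt => /predU1P[rho0|rho0]; last by left.
right; split=> //; move/eqP: rho2; rewrite -rho0 expr0n /= eq_sym paddr_eq0 ?sqr_ge0 //.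
  by rewrite sqrf_eq0 => /andP[/eqP].
by rewrite divr_ge0 ?sqr_ge0.
Qed.

Lemma radial_speed t : I t -> q t ^+ 2 = r1 ^+ 2 * (r t ^+ 2 - rho ^+ 2).
Proof.
move=> It; have [rn rNn] := chart It.
have rn0 : r t - n != 0 by rewrite subr_eq0.
rewrite rho2 /q -(momentum It).
transitivity (metric_thth n (r t) * r1 ^+ 2
              - (metric_thth n (r t) * th^`()%classic t) ^+ 2);
  last by rewrite /metric_thth; field.
by rewrite -(energy It) /metric_thth /metric_rr; field.
Qed.

Hypothesis oI : open I.
Hypothesis r_inj : {in I &, injective r}.
Hypothesis r_lim : limit_point (r @` I) rho.

Let r_cont t : I t -> {for t, continuous r}.
Proof.
by move=> It; have [/is_derive_derive1 d _] := dr It; exact: is_derive_continuous d.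
Qed.

Lemma turning_radius_le t : I t -> rho ^+ 2 <= r t ^+ 2.
Proof.
move=> It; rewrite -subr_ge0 -(@pmulr_rge0 _ (r1 ^+ 2)) ?exprn_even_gt0 //.
by rewrite -(radial_speed It) sqr_ge0.
Qed.

(** [r] cannot change sign, since [r^2 >= rho^2 > 0], and it is positive somewhere,
since it accumulates at [rho]; so [r >= rho].  Equality would be an interior
minimum, which injectivity forbids. *)
Lemma turning_radius_lt t : 0 < rho -> I t -> rho < r t.
Proof.
move=> rho0.
have r0 s : I s -> r s != 0.
  move=> /turning_radius_le; apply: contraTneq => ->.
  by rewrite expr0n /= -ltNge exprn_gt0.
have [eps epsE epsr] := nonvanishing_cst_sign iI r_cont r0.
have rpos s : I s -> 0 < r s.
  have [_ [_ [u Iu <-] ru]] := r_lim (lt_nbhsr rho0).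
  move=> Is; case: epsE epsr => -> /(_ _ _); first by move/(_ _ Is); rewrite mul1r.
  by move/(_ _ Iu); rewrite mulN1r oppr_gt0 => /(lt_trans ru); rewrite ltxx.
have rho_le s : I s -> rho <= r s.
  move=> Is; have := turning_radius_le Is.
  by rewrite ler_pXn2r ?nnegrE // ltW // rpos.
move=> It; rewrite lt_neqAle rho_le // andbT; apply/eqP => rhot.
apply: (injective_no_interior_min oI iI r_cont r_inj It) => s Is.
by rewrite -rhot rho_le.
Qed.

Lemma outside_turning_radius t : I t -> 0 < r t ^+ 2 - rho ^+ 2.
Proof.
move=> It; rewrite subr_gt0; have [rho0|[-> n0]] := turning_radius_gt0_or_flat.
  have rt := turning_radius_lt rho0 It.
  by rewrite ltr_pXn2r ?nnegrE ?(ltW rho0) // ltW // (lt_trans rho0).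
by rewrite expr0n exprn_even_gt0 //= -n0 (chart It).1.
Qed.

(** [q / r1] has square [r^2 - rho^2 > 0] and is continuous on an interval, so its
sign is constant: this sign is [eps]. *)
Lemma radial_equation :
  exists2 eps, eps = 1 \/ eps = - 1 &
    forall t, I t -> q t = eps * r1 * radial_sqrt rho (r t).
Proof.
have q2 t : I t -> (q t / r1) ^+ 2 = radial_sqrt rho (r t) ^+ 2.
  move=> It; rewrite sqr_sqrtr ?ltW ?outside_turning_radius //.
  by rewrite expr_div_n radial_speed // mulrAC divff ?mul1r // sqrf_eq0.
have [|t It|eps epsE epsq] := @nonvanishing_cst_sign R I (fun t => q t / r1) iI.
- move=> t It; have [_ /is_derive_derive1 d2] := dr It.
  have c2 := is_derive_continuous d2.
  apply: continuousM; last exact: cst_continuous.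
  apply: continuousM => //; apply: continuousD; first exact: r_cont.
  exact: cst_continuous.
- rewrite -sqrf_eq0 q2 // sqr_sqrtr ?ltW ?outside_turning_radius //.
  by rewrite gt_eqF ?outside_turning_radius.
- exists eps => // t It.
  have -> : radial_sqrt rho (r t) = eps * (q t / r1).
    apply/eqP; rewrite -(@eqrXn2 _ 2) ?sqrtr_ge0 ?ltW ?epsq //.
    by rewrite exprMn q2 //; case: epsE => ->; rewrite ?sqrrN expr1n mul1r.
  by case: epsE => ->; field.
Qed.

(** Both differences have derivative zero by [radial_equation]; the sign [eps]
enters squared in each case. *)
Lemma planar_motion_solution :
  exists2 eps, eps = 1 \/ eps = - 1 &
    (forall s t, I s -> I t ->
       s - eps / r1 * time_primitive n rho (r s)
       = t - eps / r1 * time_primitive n rho (r t)) /\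
    (forall s t, I s -> I t ->
       th s - eps * angle_primitive n (r1 / theta0) rho (r s)
       = th t - eps * angle_primitive n (r1 / theta0) rho (r t)).
Proof.
have [eps epsE qE] := radial_equation; exists eps => //.
have eps2 : eps * eps = 1 by case: epsE => ->; rewrite ?mulrNN mulr1.
split.
- apply: (derive0_interval_cst
    (f := id - (eps / r1) \*: (time_primitive n rho \o r)) iI) => t It.
  have [/is_derive_derive1 dr1 _] := dr It.
  have S0 := outside_turning_radius It.
  have nr : n = 0 \/ 0 < r t.
    case: turning_radius_gt0_or_flat => [rho0|[_ n0]]; [right|by left].
    exact: lt_trans rho0 (turning_radius_lt rho0 It).
  have dF := is_derive_time_primitive S0 nr.
  have Sp : radial_sqrt rho (r t) != 0 by rewrite gt_eqF // sqrtr_gt0.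
  apply: is_derive_eq; rewrite /GRing.scale /=.
  transitivity (1 - eps / r1 * (q t / radial_sqrt rho (r t))).
    by rewrite /q; ring.
  rewrite qE // mulfK //.
  transitivity (1 - eps * eps); last by rewrite eps2 subrr.
  by field.
- apply: (derive0_interval_cst
    (f := th - eps \*: (angle_primitive n (r1 / theta0) rho \o r)) iI) => t It.
  have [/is_derive_derive1 dr1 _] := dr It.
  have [/is_derive_derive1 dth1 _] := dth It.
  have [rn rNn] := chart It.
  have rn0 : r t - n != 0 by rewrite subr_eq0.
  have rNn0 : r t + n != 0 by rewrite addr_eq0.
  have thE : th^`()%classic t = theta0 / ((r t - n) * (r t + n)).
    by rewrite -(momentum It) /metric_thth; field; rewrite rNn0 rn0.
  (* Here [r1 / 0 = 0], so the angle primitive is constantly [atan 0 = 0]. *)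
  have [th0|th0] := eqVneq theta0 0.
    have -> : angle_primitive n (r1 / theta0) rho = cst 0.
      by apply/funext => s; rewrite /angle_primitive th0 invr0 mulr0 mul0r atan0.
    by apply: is_derive_eq; rewrite thE th0 mul0r /GRing.scale /= mul0r mulr0 subr0.
  have S0 := outside_turning_radius It.
  have e : theta0 ^+ 2 = r1 ^+ 2 * (rho ^+ 2 - n ^+ 2) by rewrite rho2; field.
  have rho0 : rho != 0.
    case: turning_radius_gt0_or_flat => [/gt_eqF ->//|[rho0 n0]].
    by move: th0; rewrite -sqrf_eq0 e rho0 n0 subrr mulr0 eqxx.
  have dA := is_derive_angle_primitive r1_neq0 th0 e S0 rho0 rn.
  have Sp : radial_sqrt rho (r t) != 0 by rewrite gt_eqF // sqrtr_gt0.
  have rE : r^`()%classic t = eps * r1 * radial_sqrt rho (r t) / (r t + n).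
    by rewrite -(qE _ It) /q mulfK.
  apply: is_derive_eq; rewrite /GRing.scale /= thE rE.
  transitivity ((1 - eps * eps) * theta0 / ((r t - n) * (r t + n))).
    by field; rewrite ?rn0 ?rNn0 ?Sp.
  by rewrite eps2 subrr !mul0r.
Qed.

End PlanarMotion.

Theorem theorem3p4 (R : realType) (n r1 theta0 t1 theta1 : R)
  (I : set R) (x : R -> 'rV[R]_4) (T : R -> R) :
  let R3 : R := Num.sqrt (n ^+ 2 + theta0 ^+ 2 / r1 ^+ 2) in
  let rad : R -> R := xcoord x i_r in
  let theta : R -> R := xcoord x i_theta in
  let J : set R := rad @` I in
  r1 != 0 ->
  open I -> is_interval I ->
  (forall t, I t -> taubnut_chart n (x t)) ->
  geodesic_on (taubnut n) I x ->
  (exists phi_c : R, forall t, I t -> xcoord x i_phi t = phi_c) ->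
  (exists tau_c : R, forall t, I t -> xcoord x i_tau t = tau_c) ->
  (forall t, I t -> T (rad t) = t) ->
  limit_point J R3 ->
  T r @[r --> within J R3^'] --> t1 ->
  theta (T r) @[r --> within J R3^'] --> theta1 ->
  (r ^+ 2 - n ^+ 2) * theta^`()%classic (T r) @[r --> within J R3^'] --> theta0 ->
  (r + n) / (r - n) * rad^`()%classic (T r) ^+ 2 + theta0 ^+ 2 / (r ^+ 2 - n ^+ 2)
    @[r --> within J R3^'] --> r1 ^+ 2 ->
  exists2 eps : R, eps = 1 \/ eps = - 1 &
    exists t1' theta1' : R,
      [/\ t1' = t1 - eps / r1 * (n * ln R3),
          theta1' = theta1 + eps * Num.sg (r1 * theta0) * (pi / 2) &
          forall r, J r ->
            T r = t1' + eps / r1 *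
              (Num.sqrt (r ^+ 2 - R3 ^+ 2)
               + n * ln (r + Num.sqrt (r ^+ 2 - R3 ^+ 2))) /\
            theta (T r) = theta1' + eps *
              atan (r1 * (r * n - R3 ^+ 2)
                    / (theta0 * Num.sqrt (r ^+ 2 - R3 ^+ 2)))].
Proof.
move=> R3 rad theta J r10 oI iI chart geo [phi_c phiE] [tau_c tauE] TK Jlim.
move=> T_lim theta_lim momentum_lim energy_lim.
have pF := limit_point_within_proper Jlim.
have R3_ge0 : 0 <= R3 by exact: sqrtr_ge0.
have R3sq : R3 ^+ 2 = n ^+ 2 + theta0 ^+ 2 / r1 ^+ 2.
  by rewrite sqr_sqrtr // addr_ge0 ?divr_ge0 ?sqr_ge0.
have [t0 It0] : exists t, I t.
  by have [|_ [_ [t It _] _]] := Jlim setT; [exact: filterT|exists t].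
have radchart t : I t -> rad t != n /\ rad t != - n by case/chart.
have drad t : I t -> derivable rad t 1 /\ derivable rad^`()%classic t 1.
  by move=> It; have [d1 d2 _] := geo _ It i_r; split; [exact: d1|exact: d2].
have dtheta t : I t -> derivable theta t 1 /\ derivable theta^`()%classic t 1.
  by move=> It; have [d1 d2 _] := geo _ It i_theta; split; [exact: d1|exact: d2].
have dtau t It := derive1_locally_cst (t := t) oI tauE It.
have dphi t It := derive1_locally_cst (t := t) oI phiE It.
have eqth t (It : I t) :=
  geodesic_theta_equation It geo (chart _ It) (dtau _ It) (dphi _ It).
have eqr t (It : I t) :=
  geodesic_r_equation It geo (chart _ It) (dtau _ It) (dphi _ It).
have momentum t : I t -> metric_thth n (rad t) * theta^`()%classic t = theta0.
  move=> It; apply: (limits_agree (f := cst _) Jlim _ (cvg_cst _) momentum_lim).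
  move=> _ [s Is <-]; rewrite /= TK //.
  exact: (angular_momentum_conserved iI drad dtheta eqth).
have energy t : I t -> metric_rr n (rad t) * rad^`()%classic t ^+ 2
    + metric_thth n (rad t) * theta^`()%classic t ^+ 2 = r1 ^+ 2.
  move=> It; apply: (limits_agree (f := cst _) Jlim _ (cvg_cst _) energy_lim).
  move=> _ [s Is <-]; rewrite /= TK // -(momentum _ Is).
  rewrite (energy_conserved iI radchart drad dtheta eqth eqr It Is).
  have [rn rNn] := radchart _ Is.
  rewrite /metric_rr /metric_thth subr_sqr; field.
  by rewrite addr_eq0 rNn subr_eq0 rn.
have rad_inj : {in I &, injective rad}.
  by move=> s t; rewrite !inE => Is It e; rewrite -(TK _ Is) e TK.
have [eps epsE [timeE angleE]] := planar_motion_solution iI radchart drad dtheta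
  r10 R3_ge0 R3sq momentum energy oI rad_inj Jlim.
have R3n := turning_radius_gt0_or_flat R3_ge0 R3sq.
(* The constants of integration [C] and [D] are the witnesses t1' and theta1'. *)
pose C := t0 - eps / r1 * time_primitive n R3 (rad t0).
pose D := theta t0 - eps * angle_primitive n (r1 / theta0) R3 (rad t0).
have TE r : J r -> T r = C + eps / r1 * time_primitive n R3 r.
  by case=> t It <-; rewrite TK // /C (timeE _ _ It0 It) subrK.
have thetaE r : J r ->
    theta (T r) = D + eps * angle_primitive n (r1 / theta0) R3 r.
  by case=> t It <-; rewrite TK // /D (angleE _ _ It0 It) subrK.
exists eps => //; exists C, D; split.
- have flim : C + eps / r1 * time_primitive n R3 r @[r --> within J R3^'] -->
      C + eps / r1 * (n * ln R3).
    apply: cvgD; first exact: cvg_cst.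
    apply: cvgM; first exact: cvg_cst.
    by apply: time_primitive_cvg; case: R3n => [|[]]; [left|right].
  by rewrite (limits_agree Jlim TE T_lim flim) addrK.
- have flim : D + eps * angle_primitive n (r1 / theta0) R3 r
      @[r --> within J R3^'] -->
      D + eps * - (Num.sg (r1 * theta0) * (pi / 2)).
    apply: cvgD; first exact: cvg_cst.
    apply: cvgM; first exact: cvg_cst.
    have [th0|th0] := eqVneq theta0 0.
      rewrite th0 mulr0 sgr0 mul0r oppr0 invr0 mulr0.
      rewrite (_ : angle_primitive n 0 R3 = cst 0); first exact: cvg_cst.
      by apply/funext => s; rewrite /angle_primitive mul0r atan0.
    have R3n2 : n ^+ 2 < R3 ^+ 2.
      by rewrite R3sq ltrDl divr_gt0 ?exprn_even_gt0.
    have nR3 : `|n| < R3.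
      by rewrite -(@ltr_pXn2r _ 2) ?nnegrE // real_normK ?num_real.
    have R30 : 0 < R3 by exact: le_lt_trans nR3.
    have -> : Num.sg (r1 * theta0) = Num.sg (r1 / theta0) by rewrite !sgrM sgrV.
    apply: angle_primitive_cvg => //.
    + exact: le_lt_trans (ler_norm n) nR3.
    + by rewrite mulf_neq0 ?invr_eq0.
    + move=> _ [t It <-].
      exact: (turning_radius_lt iI radchart drad r10 R3_ge0 R3sq momentum energy).
  by rewrite (limits_agree Jlim thetaE theta_lim flim); ring.
- move=> r Jr; split; first exact: TE.
  rewrite thetaE // /angle_primitive; congr (_ + _ * atan _).
  by rewrite invfM mulrACA.
Qed.
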